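(* Let $F$ be a field of prime characteristic $p$, let $K\le G$ be two finite groups, and let $R\le G$ be a $p$-group. Then for every $p$-permutation $FK$-module $V$ there is an isomorphism of $FN_G(R)$-modules $$\left(V\uparrow^G\right)(R)\;\cong\;\bigoplus_{\substack{x\in N_G(R)\backslash G/K\\ R\le {}^{x}K}}\left({}^{x}V\right)(R)\uparrow^{N_G(R)},$$ where $x$ runs over a set of representatives of the $(N_G(R),K)$-double cosets in $G$ with $R\le{}^xK$.
   Context: $\uparrow$ denotes induction of modules, ${}^xK=xKx^{-1}$, and ${}^xV$ is the $F({}^xK)$-module with underlying space $\{x\}\otimes V$ and action $(xkx^{-1})(x\otimes v)=x\otimes kv$. All modules are finite-dimensional. An $FG$-module $V$ is a $p$-permutation module if for every Sylow $p$-subgroup $Q$ of $G$ there is a basis of $V$ permuted by $Q$ (equivalently, $V$ is a direct summand of a permutation module). For a $p$-permutation $FG$-module $V$ and a $p$-subgroup $R\le G$, $V(R)$ denotes the Brauer construction, an $FN_G(R)$-module: choosing a Sylow $p$-subgroup $Q\ge R$ of $G$ and a $Q$-invariant basis $\mathcal I$ of $V$, $V(R)$ has as $F$-basis the set of $R$-fixed elements of $\mathcal I$, and, canonically and independently of choices, $V(R)=V^R/\sum_{T<R}\mathrm{Tr}_T^R(V^T)$ (sum over proper subgroups $T$ of $R$, with $\mathrm{Tr}_T^R$ the relative trace) with the induced action of $N_G(R)$. In the formula, $({}^xV)(R)$ is an $FN_{{}^xK}(R)$-module, which is then induced to $N_G(R)$. *)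

(* Defs.v *)
From HB Require Import structures.
From mathcomp Require Import all_boot all_order all_fingroup all_algebra.
From mathcomp Require Import all_solvable all_field all_character.

Set Implicit Arguments.
Unset Strict Implicit.
Unset Printing Implicit Defensive.

Import GroupScope GRing.Theory.
Local Open Scope ring_scope.

(* An FG-module is an mx_representation rG : G -> GL_n(F).  As everywhere in
   mxrepresentation, the underlying space is that of row vectors, on which g
   acts by v |-> v *m rG g.  This is a right action; the left FG-module it
   stands for has g.v = v *m rG g^-1.  Submodules, fixed points, relative
   traces and isomorphisms (mx_rsim) are the same for both actions, and the
   formulas for ^xV and for the matrices of an induced module hold verbatim
   in either convention. *)

Section Conjugate.

Variables (F : fieldType) (gT : finGroupType) (K : {group gT}) (n : nat).
Variables (rV : mx_representation F K n) (x : gT).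

Lemma conj_mx_repr : mx_repr (K :^ x^-1)%G (fun g => rV (g ^ x)%g).
Proof.
split=> [|g h Kg Kh]; first by rewrite conj1g repr_mx1.
by rewrite conjMg repr_mxM // -mem_conjgV.
Qed.

(* ^xK = x K x^-1 is K :^ x^-1, and x k x^-1 acts on ^xV as k acts on V. *)
Definition conj_repr : mx_representation F (K :^ x^-1)%G n :=
  MxRepresentation conj_mx_repr.

End Conjugate.

Section Induction.

Variables (F : fieldType) (gT : finGroupType) (G K : {group gT}) (n : nat).
Variable rV : mx_representation F K n.

Definition ind_rep (i : 'I_#|lcosets K G|) : gT := repr (enum_val i).

(* The matrix of g on FG (x)_{FK} V in the basis t_i (x) v_a, where the t_i
   represent the left cosets of K in G and (v_a) is the standard basis of V:
   the block (i, j) is rV (t_i^-1 g t_j) if t_i^-1 g t_j is in K, and 0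
   otherwise. *)
Definition ind_mx (g : gT) : 'M[F]_(\sum_(i < #|lcosets K G|) n) :=
  \mxblock_(i < #|lcosets K G|, j < #|lcosets K G|)
    (if ((ind_rep i)^-1 * g * ind_rep j)%g \in K
     then rV ((ind_rep i)^-1 * g * ind_rep j)%g else 0).

Lemma ind_repK i : (ind_rep i *: K)%g = enum_val i.
Proof.
rewrite /ind_rep; case/lcosetsP: (enum_valP i) => y _ ->.
apply/lcoset_eqP; exact: (mem_repr y (lcoset_refl K y)).
Qed.

Lemma ind_rep_mem i j g :
  (((ind_rep i)^-1 * g * ind_rep j)%g \in K)
    = (enum_val j == (g^-1 *: enum_val i)%g).
Proof.
rewrite -!ind_repK -lcosetM; apply/idP/eqP => [h|].
  by apply/lcoset_eqP; rewrite mem_lcoset invMg invgK.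
by move/lcoset_eqP; rewrite mem_lcoset invMg invgK.
Qed.

Lemma ind_mx_repr : mx_repr G ind_mx.
Proof.
split=> [|g h Gg Gh].
  rewrite -mxdiagZ; apply/eq_mxblockP => i j.
  rewrite ind_rep_mem invg1 lcoset1 (inj_eq enum_val_inj) eq_sym.
  case: eqVneq => [->|ne]; last by [].
  by rewrite conform_mx_id mulg1 mulVg repr_mx1.
rewrite mul_mxblock; apply/eq_mxblockP => i k.
have Sj: (g^-1 *: enum_val i)%g \in lcosets K G.
  have /lcosetsP[y Gy ->] := enum_valP i.
  by apply/lcosetsP; exists (g^-1 * y)%g; rewrite ?lcosetM // groupM ?groupV.
pose j := enum_rank_in Sj (g^-1 *: enum_val i)%g.
have ej: enum_val j = (g^-1 *: enum_val i)%g by rewrite enum_rankK_in.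
have Kij: ((ind_rep i)^-1 * g * ind_rep j)%g \in K by rewrite ind_rep_mem ej.
rewrite (bigD1 j) //= Kij big1 ?addr0 => [|j' nj]; last first.
  by rewrite ind_rep_mem -ej (inj_eq enum_val_inj) (negPf nj) mul0mx.
have eM: ((ind_rep i)^-1 * (g * h) * ind_rep k
   = ((ind_rep i)^-1 * g * ind_rep j) * ((ind_rep j)^-1 * h * ind_rep k))%g.
  by rewrite !mulgA mulgK.
rewrite eM groupMl //; case: ifP => Kjk; last by rewrite mulmx0.
by rewrite repr_mxM.
Qed.

Definition ind_repr := MxRepresentation ind_mx_repr.

End Induction.

Section Brauer.

Variables (F : fieldType) (gT : finGroupType) (G : {group gT}) (n : nat).
Variable rV : mx_representation F G n.

(* Tr_T^R on V^T; here v *m rV r = r^-1.v, so that right cosets T r correspond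
   to the left cosets r^-1 T over which Tr_T^R is usually written. *)
Definition rel_trace_mx (T R : {set gT}) : 'M[F]_n :=
  \sum_(A in rcosets T R) rV (repr A).

Definition trace_space (R : {set gT}) : 'M[F]_n :=
  (\sum_(T : {group gT} | T \proper R) rfix_mx rV T *m rel_trace_mx T R)%MS.

Variables (R : {group gT}) (sRG : R \subset G).

Definition norm_repr : mx_representation F 'N_G(R)%G n :=
  subg_repr rV (subsetIl G 'N(R)).

Lemma fixed_module : mxmodule norm_repr (rfix_mx rV R).
Proof. by apply: (normal_rfix_mx_module norm_repr); rewrite normalSG. Qed.

Lemma trace_module : mxmodule norm_repr (trace_space R).
Proof.
apply/mxmoduleP => x /setIP[Gx nRx] /=.
rewrite /trace_space sumsmxMr.
apply/sumsmx_subP => T prT.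
have sTR := proper_sub prT; have sTG := subset_trans sTR sRG.
have prTx: (T :^ x)%G \proper R by rewrite -(normP nRx) properJ.
apply: (sumsmx_sup (T :^ x)%G) => //.
have fixW: (rfix_mx rV T *m rV x <= rfix_mx rV (T :^ x))%MS.
  by rewrite rfix_mx_conjsg.
suff ->: rfix_mx rV T *m rel_trace_mx T R *m rV x
       = rfix_mx rV T *m rV x *m rel_trace_mx (T :^ x) R by exact: submxMr.
have fixT t: t \in T -> rfix_mx rV T *m rV t = rfix_mx rV T.
  by move=> Tt; apply: rfix_mx_id.
move: (rfix_mx rV T) fixT {fixW} => W fixT.
have rcosJ: rcosets (T :^ x) R = [set A :^ x | A : {set gT} in rcosets T R].
  apply/setP=> B; apply/rcosetsP/imsetP => [[y Ry ->]|[_ /rcosetsP[y Ry ->] ->]].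
    exists (T :* (y ^ x^-1))%g.
      by apply/rcosetsP; exists (y ^ x^-1)%g; rewrite ?memJ_norm ?groupV.
    by rewrite conjsMg conjg_set1 conjgKV.
  by exists (y ^ x)%g; rewrite ?memJ_norm // conjsMg conjg_set1.
rewrite /rel_trace_mx rcosJ.
rewrite [in RHS]big_imset /=; last by move=> A B _ _; apply: conjsg_inj.
rewrite mulmx_sumr mulmx_suml mulmx_sumr.
apply: eq_bigr => A /rcosetsP[y Ry ->].
have: repr ((T :* y) :^ x)%g \in ((T :* y) :^ x)%g.
  by apply: (mem_repr (y ^ x)%g); rewrite memJ_conjg rcoset_refl.
have: repr (T :* y)%g \in (T :* y)%g := mem_repr y (rcoset_refl T y).
move: (repr _) (repr _) => u v.
case/rcosetP => t Tt ->; case/imsetP => _ /rcosetP[t' Tt' ->] ->.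
have [Gt Gt'] := (subsetP sTG t Tt, subsetP sTG t' Tt').
have Gy := subsetP sRG y Ry.
rewrite -(mulmxA W (rV x)) -repr_mxM ?groupJ ?groupM // -conjgC.
by rewrite !repr_mxM ?groupM // !mulmxA (fixT t) ?(fixT t').
Qed.

(* V(R) = V^R / sum_{T < R} Tr_T^R (V^T), as an F N_G(R)-module. *)
Definition brauer_repr := section_repr trace_module fixed_module.

End Brauer.

Definition p_permutation (F : fieldType) (gT : finGroupType) (G : {group gT})
    (p n : nat) (rV : mx_representation F G n) : Prop :=
  forall Q : {group gT}, p.-Sylow(G) Q ->
  exists2 B : 'M[F]_n, B \in unitmx &
    forall g, g \in Q -> forall i, exists j, row i B *m rV g = row j B.

(* X meets every double coset N x K, x in G, exactly once. *)
Definition double_coset_reps (gT : finGroupType) (G N K X : {set gT}) : bool :=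
  is_transversal X [set (N :* x * K)%g | x in G] G.

(* Main.v *)
Require Import Defs.
From mathcomp Require Import all_boot all_order all_fingroup all_algebra.
From mathcomp Require Import all_solvable all_field all_character.

Set Implicit Arguments.
Unset Strict Implicit.
Unset Printing Implicit Defensive.

Import GroupScope GRing.Theory.
Local Open Scope ring_scope.

(** Write M for the induced module and N for N_G(R).  M is the direct sum of its
    blocks t (x) V, one for each coset tK, and R permutes the blocks.  An R-fixed
    vector splits along the R-orbits of cosets.  On an orbit with more than one
    element it is a relative trace from the stabiliser of any block of the
    orbit, a proper subgroup of R, so it dies in M(R)
    ([trace_space_fixed_cosets]).  What survives is the sum of the blocks with
    R <= tKt^-1, and for such a block fixed points and traces are those of the
    module ^tV.  Hence M(R) is the direct sum of the (^tV)(R) over the cosets tK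
    fixed by R.  The group N permutes these cosets; its orbits are the double
    cosets N x K with R <= xKx^-1, and the stabiliser of xK is N_{xKx^-1}(R), so
    each orbit contributes (^xV)(R) induced to N.

    The isomorphism is never written down.  For each representative x,
    [mackey_map] sends a vector of M to its coordinates in the blocks s x (x) V,
    s in N, each reduced to (^xV)(R).  It is N-equivariant on M^R, and the maps
    for all x are assembled into one map h to the direct sum
    ([dsum_joint_map]).  On M^R this h is surjective ([mackey_section]) and its
    kernel is the space of traces; since the projection onto M(R) has the same
    kernel, the two targets are isomorphic ([quotient_map_rsim]).

    The matrices act on row vectors from the right, so that block t should be
    read as V (x) t^-1, and the formulas below carry g^-1 where a left action
    would have g. *)

(** * Subquotients and the maps that present them *)

Section QuotientMap.

Variables (F : fieldType) (gT : finGroupType) (N : {group gT}) (n : nat).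
Variable rG : mx_representation F N n.

(** f presents rH as V / (U :&: V).  Only the restriction of f to V is
    constrained, so that a map given on all of M can be used without first
    cutting it down to M^R. *)
Definition quotient_map (U V : 'M[F]_n) (m : nat)
    (rH : mx_representation F N m) (f : 'M[F]_(n, m)) : Prop :=
  [/\ row_full (V *m f),
      forall k (A : 'M_(k, n)), (A <= V)%MS -> (A *m f == 0) = (A <= U)%MS
    & forall k (A : 'M_(k, n)) g, g \in N -> (A <= V)%MS ->
        A *m rG g *m f = A *m f *m rH g].

(** Surjectivity of f1 provides a linear lift A of its target into V; the
    isomorphism is A followed by f2.  Two lifts differ by a vector of U, which
    f2 kills, so the composite is equivariant although A need not be. *)
Lemma quotient_map_rsim (U V : 'M[F]_n) m1 m2
    (r1 : mx_representation F N m1) (r2 : mx_representation F N m2) f1 f2 :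
    mxmodule rG V -> quotient_map U V r1 f1 -> quotient_map U V r2 f2 ->
  mx_rsim r1 r2.
Proof.
move=> modV [full1 ker1 equi1] [full2 ker2 equi2].
have /submxP[D1 eD1] : (1%:M <= V *m f1)%MS by rewrite submx_full.
have /submxP[D2 eD2] : (1%:M <= V *m f2)%MS by rewrite submx_full.
rewrite mulmxA in eD1; rewrite mulmxA in eD2.
pose A := D1 *m V; pose E := D2 *m V.
have sAV : (A <= V)%MS by apply: submxMl.
have sEV : (E <= V)%MS by apply: submxMl.
have eq12 k (B C : 'M_(k, n)) : (B <= V)%MS -> (C <= V)%MS ->
    B *m f1 = C *m f1 -> B *m f2 = C *m f2.
  move=> sBV sCV eBC; apply/eqP; rewrite -subr_eq0 -mulmxBl.
  have sBCV : (B - C <= V)%MS by rewrite addmx_sub // eqmx_opp.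
  by rewrite ker2 // -ker1 // mulmxBl eBC subrr.
have freeB : row_free (A *m f2).
  rewrite -kermx_eq0; apply/rowV0P => u /sub_kermxP /eqP.
  have suV : (u *m A <= V)%MS := submx_trans (submxMl u A) sAV.
  by rewrite mulmxA ker2 // -ker1 // -mulmxA -eD1 mulmx1 => /eqP.
have fullB : row_full (A *m f2).
  rewrite -sub1mx eD2 -/E (eq12 _ E (E *m f1 *m A)) //.
  - by rewrite -mulmxA submxMl.
  - by rewrite (submx_trans (submxMl _ _)).
  by rewrite -(mulmxA (E *m f1)) -eD1 mulmx1.
exists (A *m f2) => //.
  by rewrite -(eqP freeB); apply/eqP.
move=> g Ng; rewrite -equi2 // mulmxA; apply: eq12.
- by rewrite (submx_trans (submxMl _ _)).
- exact: submx_trans (submxMr _ sAV) (mxmoduleP modV g Ng).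
by rewrite equi1 // -(mulmxA (r1 g)) -eD1 mulmx1 mul1mx.
Qed.

Section SectionProj.

Variables (U V : 'M[F]_n) (modU : mxmodule rG U) (modV : mxmodule rG V).

Definition section_proj : 'M[F]_(n, \rank <<in_factmod U V>>%MS) :=
  in_factmod U 1%:M *m in_submod <<in_factmod U V>>%MS 1%:M.

Lemma section_projP : quotient_map U V (section_repr modU modV) section_proj.
Proof.
have projE k (A : 'M_(k, n)) :
    A *m section_proj = in_submod <<in_factmod U V>>%MS (in_factmod U A).
  by rewrite mulmxA -in_factmodE -in_submodE.
have sub k (A : 'M_(k, n)) : (A <= V)%MS ->
    (in_factmod U A <= <<in_factmod U V>>)%MS.
  by move=> sAV; rewrite genmxE submxMr.
split=> [|k A sAV|k A g Ng sAV].
- by rewrite /row_full projE mxrank_in_submod ?sub // genmxE.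
- rewrite projE -in_factmod_eq0 -[in RHS](in_submodK (sub _ _ sAV)).
  by rewrite val_submod_eq0.
- rewrite !projE (in_factmodJ modU A Ng).
  exact: (in_submodJ (section_module modU modV) g (sub _ _ sAV)).
Qed.

End SectionProj.

End QuotientMap.

Section BrauerProj.

Variables (F : fieldType) (gT : finGroupType) (G R : {group gT}) (n : nat).
Variables (rV : mx_representation F G n) (sRG : R \subset G).

Definition brauer_proj := section_proj (trace_space rV R) (rfix_mx rV R).

Lemma brauer_projP :
  quotient_map (norm_repr rV R) (trace_space rV R) (rfix_mx rV R)
    (brauer_repr rV sRG) brauer_proj.
Proof. exact: section_projP. Qed.

End BrauerProj.

Section JointMap.

Variables (F : fieldType) (gT : finGroupType) (N : {group gT}) (n : nat).
Variable rG : mx_representation F N n.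
Variables (I : eqType) (r : I -> representation F N).
Variable f : forall i, 'M[F]_(n, rdegree (r i)).

(** Stated as an existence because the target is an iterated direct sum whose
    dimension depends on e.  The third clause is a criterion for surjectivity on
    W: each component is already surjective on vectors of W killed by all
    the others.  It is stated for every W so that the induction may
    replace W by its intersection with the kernel of the first component. *)
Lemma dsum_joint_map (e : seq I) : uniq e ->
  exists h : 'M[F]_(n, rdegree (\big[dadd_grepr/grepr0]_(i <- e) r i)),
  [/\ forall k (A : 'M_(k, n)),
        A *m h = 0 <-> (forall i, i \in e -> A *m f i = 0),
      forall k (A : 'M_(k, n)) g,
        (forall i, i \in e -> A *m rG g *m f i = A *m f i *m r i g) ->
        A *m rG g *m h = A *m h *m (\big[dadd_grepr/grepr0]_(i <- e) r i) g
    & forall W : 'M_n,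
        (forall i, i \in e -> exists A : 'M_n, [/\ (A <= W)%MS,
           row_full (A *m f i)
         & forall j, j \in e -> j != i -> A *m f j = 0]) ->
        row_full (W *m h)].
Proof.
elim: e => [_|a e IHe /= /andP[nea /IHe[h [kerh equih fullh]]]].
  rewrite big_nil; exists 0; split=> [k A|k A g _|W _].
  - by rewrite mulmx0; split.
  - by rewrite !mulmx0 mul0mx.
  - by rewrite /row_full mulmx0 mxrank0.
rewrite big_cons; exists (row_mx (f a) h); split=> [k A|k A g equi|W ex].
- rewrite mul_mx_row; split=> [eq0 i|].
    have /eq_row_mx[fa0 /kerh h0] :
      row_mx (A *m f a) (A *m h) = row_mx 0 0 by rewrite row_mx0.
    by rewrite inE => /predU1P[-> //|/h0].
  move=> f0; rewrite f0 ?mem_head // (kerh _ _).2 ?row_mx0 // => i ei.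
  by rewrite f0 // inE ei orbT.
- rewrite /= !mul_mx_row mul_row_block !mulmx0 addr0 add0r.
  rewrite equi ?mem_head // equih // => i ei.
  by rewrite equi // inE ei orbT.
have [A [sAW fullA A0]] := ex a (mem_head _ _).
have Ah0 : A *m h = 0.
  apply/kerh => i ei; rewrite A0 ?inE ?ei ?orbT //.
  by apply: contraNneq nea => <-.
pose W' := (W :&: kermx (f a))%MS.
have fullW' : row_full (W' *m h).
  apply: fullh => i ei.
  have [|B [sBW fullB B0]] := ex i; first by rewrite inE ei orbT.
  exists B; split=> // [|j ej]; last by apply: B0; rewrite inE ej orbT.
  rewrite sub_capmx sBW; apply/sub_kermxP; apply: B0; first exact: mem_head.
  by apply: contraNneq nea => ->.
rewrite -sub1mx /= scalar_mx_block /block_mx col_mx_sub.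
have sW'W : (W' <= W)%MS by apply: capmxSl.
have W'0 : W' *m f a = 0 by apply/sub_kermxP; apply: capmxSr.
apply/andP; split.
  apply: submx_trans (submxMr _ sAW); rewrite mul_mx_row Ah0.
  have /submxP[D eD] := submx_full (1%:M : 'M_(rdegree (r a))) fullA.
  by apply/submxP; exists D; rewrite mul_mx_row mulmx0 -eD.
apply: submx_trans (submxMr _ sW'W); rewrite mul_mx_row W'0.
have /submxP[D eD] : (1%:M <= W' *m h)%MS by rewrite submx_full.
by apply/submxP; exists D; rewrite mul_mx_row mulmx0 -eD.
Qed.

End JointMap.

(** * Coordinates on an induced module *)

Lemma repr_rcosets_mem (gT : finGroupType) (H R : {group gT}) (A : {set gT}) :
  H \subset R -> A \in rcosets H R -> repr A \in R.
Proof.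
move=> sHR /rcosetsP[r Rr ->].
have /rcosetP[z Hz ->] := mem_repr r (rcoset_refl H r).
by rewrite groupM // (subsetP sHR).
Qed.

Lemma repr_lcosets_mem (gT : finGroupType) (H R : {group gT}) (A : {set gT}) :
  H \subset R -> A \in lcosets H R -> repr A \in R.
Proof.
move=> sHR /lcosetsP[r Rr ->].
have /lcosetP[z Hz ->] := mem_repr r (lcoset_refl H r).
by rewrite groupM // (subsetP sHR).
Qed.

Section InducedCoordinates.

Variables (F : fieldType) (gT : finGroupType) (G K : {group gT}) (n : nat).
Variables (sKG : K \subset G) (rV : mx_representation F K n).

(** All matrix entries between blocks have this form, so that the matrices of
    induced modules multiply by [zero_ext_conv] below. *)
Definition zero_ext (g : gT) : 'M[F]_n := if g \in K then rV g else 0.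

(** The map v |-> v (x) t^-1.  It is defined for every t rather than for
    the chosen representatives, which makes its transformation laws free of
    correction factors. *)
Definition ind_inj (t : gT) : 'M[F]_(n, \sum_(i < #|lcosets K G|) n) :=
  \mxrow_(j < #|lcosets K G|) zero_ext (t^-1 * ind_rep j)%g.

(** The coordinate in the block tK, read through the representative t. *)
Definition ind_proj (t : gT) : 'M[F]_(\sum_(i < #|lcosets K G|) n, n) :=
  \mxcol_(i < #|lcosets K G|) zero_ext ((ind_rep i)^-1 * t)%g.

Lemma zero_ext_mulr a k : k \in K -> zero_ext (a * k)%g = zero_ext a *m rV k.
Proof.
move=> Kk; rewrite /zero_ext groupMr //; case: ifP => Ka; last by rewrite mul0mx.
by rewrite repr_mxM.
Qed.

Lemma zero_ext_mull a k : k \in K -> zero_ext (k * a)%g = rV k *m zero_ext a.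
Proof.
move=> Kk; rewrite /zero_ext groupMl //; case: ifP => Ka; last by rewrite mulmx0.
by rewrite repr_mxM.
Qed.

Lemma ind_rep_in (i : 'I_#|lcosets K G|) : ind_rep i \in G.
Proof.
exact: repr_lcosets_mem sKG (enum_valP i).
Qed.

(** Only the coset of a^-1 gives a nonzero term. *)
Lemma zero_ext_conv a b : a \in G ->
  \sum_(j < #|lcosets K G|)
     zero_ext (a * ind_rep j)%g *m zero_ext ((ind_rep j)^-1 * b)%g
  = zero_ext (a * b)%g.
Proof.
move=> Ga.
have Sj : (a^-1 *: K)%g \in lcosets K G.
  by apply/lcosetsP; exists a^-1%g; rewrite ?groupV.
pose j := enum_rank_in Sj (a^-1 *: K)%g.
have ej : enum_val j = (a^-1 *: K)%g by rewrite enum_rankK_in.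
have memK i : (a * ind_rep i)%g \in K = (i == j).
  rewrite -(inj_eq enum_val_inj) ej -ind_repK; apply/idP/eqP => [Ki|].
    by apply/lcoset_eqP; rewrite mem_lcoset invgK.
  by move/lcoset_eqP; rewrite mem_lcoset invgK.
rewrite (bigD1 j) //= big1 ?addr0 => [|i ni]; last first.
  by rewrite /zero_ext memK (negPf ni) mul0mx.
have Kj : (a * ind_rep j)%g \in K by rewrite memK.
by rewrite {1}/zero_ext Kj -zero_ext_mull // !mulgA mulgK.
Qed.

Lemma ind_injJ t g : t \in G -> ind_inj t *m ind_repr G rV g = ind_inj (g^-1 * t)%g.
Proof.
move=> Gt; rewrite /= /ind_inj /ind_mx mul_mxrow_mxblock; apply/eq_mxrowP => k.
rewrite invMg invgK -mulgA -(zero_ext_conv _ (groupVr Gt)).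
by apply: eq_bigr => j _; rewrite !mulgA.
Qed.

Lemma ind_projJ t g : g \in G -> ind_repr G rV g *m ind_proj t = ind_proj (g * t)%g.
Proof.
move=> Gg; rewrite /= /ind_proj /ind_mx mul_mxblock_mxrow; apply/eq_mxcolP => i.
by rewrite mulgA -zero_ext_conv // groupM // groupV ind_rep_in.
Qed.

Lemma ind_injK t s : t \in G -> ind_inj t *m ind_proj s = zero_ext (t^-1 * s)%g.
Proof. by move=> Gt; rewrite mul_mxrow_mxcol zero_ext_conv // groupV. Qed.

Lemma ind_inj_mulr t k : k \in K -> ind_inj (t * k)%g = rV k^-1%g *m ind_inj t.
Proof.
move=> Kk; rewrite /ind_inj mul_mxrow; apply/eq_mxrowP => j.
by rewrite invMg -mulgA zero_ext_mull // groupV.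
Qed.

Lemma ind_proj_mulr t k : k \in K -> ind_proj (t * k)%g = ind_proj t *m rV k.
Proof.
move=> Kk; rewrite /ind_proj mxcol_mul; apply/eq_mxcolP => j.
by rewrite mulgA zero_ext_mulr.
Qed.

(** The idempotent of M that cuts out the block C; [coset_projE] shows that it
    does not depend on the representative. *)
Definition coset_proj (C : {set gT}) := ind_proj (repr C) *m ind_inj (repr C).

Lemma coset_projE t : coset_proj (t *: K)%g = ind_proj t *m ind_inj t.
Proof.
rewrite /coset_proj; have /lcosetP[k Kk ->] := mem_repr t (lcoset_refl K t).
rewrite ind_proj_mulr // ind_inj_mulr // mulmxA -(mulmxA _ (rV k)) -repr_mxM ?groupV //.
by rewrite mulgV repr_mx1 mulmx1.
Qed.

Lemma sum_coset_proj : \sum_(C in lcosets K G) coset_proj C = 1%:M.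
Proof.
rewrite -(repr_mx1 (ind_repr G rV)) /= /ind_mx [LHS]big_enum_val /=.
rewrite (eq_bigr (fun k : 'I__ => \mxblock_(i, j)
   (zero_ext ((ind_rep i)^-1 * ind_rep k)%g
      *m zero_ext ((ind_rep k)^-1 * ind_rep j)%g))).
  rewrite -mxblock_sum; apply/eq_mxblockP => i j.
  by rewrite zero_ext_conv ?groupV ?ind_rep_in // mulg1.
by move=> k _; rewrite /coset_proj -mul_mxcol_mxrow.
Qed.

(** A vector is determined by its coordinates: this is how identities between
    maps into an induced module are checked, without ever choosing coset
    representatives. *)
Lemma ind_proj_inj k (A B : 'M_(k, _)) :
  (forall t, t \in G -> A *m ind_proj t = B *m ind_proj t) -> A = B.
Proof.
move=> eAB; rewrite -[A]mulmx1 -[B]mulmx1 -sum_coset_proj !mulmx_sumr.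
apply: eq_bigr => _ /lcosetsP[t Gt ->].
by rewrite coset_projE !mulmxA eAB.
Qed.

End InducedCoordinates.

(** * Maps that commute with R preserve fixed points and traces *)

Section Intertwiner.

Variables (F : fieldType) (gT : finGroupType) (R : {group gT}).
Variables (G1 G2 : {group gT}) (n1 n2 : nat).
Variables (r1 : mx_representation F G1 n1) (r2 : mx_representation F G2 n2).
Variable h : 'M[F]_(n1, n2).
Hypothesis homh : forall g, g \in R -> r1 g *m h = h *m r2 g.

Lemma intertwine_rfix (T : {set gT}) k (A : 'M_(k, n1)) :
  T \subset R -> (A <= rfix_mx r1 T)%MS -> (A *m h <= rfix_mx r2 T)%MS.
Proof.
move=> sTR /rfix_mxP fixA; apply/rfix_mxP => g Tg.
by rewrite -mulmxA -homh ?(subsetP sTR) // mulmxA fixA.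
Qed.

(** Relative traces from subgroups of R involve the action of R alone, so the
    map may go between modules for different groups; below it goes between ^xV
    and M, in both directions. *)
Lemma intertwine_trace k (A : 'M_(k, n1)) :
  (A <= trace_space r1 R)%MS -> (A *m h <= trace_space r2 R)%MS.
Proof.
move/(submxMr h)/submx_trans; apply.
rewrite /trace_space sumsmxMr_gen; apply/sumsmx_subP => T prT.
rewrite genmxE; apply: (sumsmx_sup T) => //.
have homTr : rel_trace_mx r1 T R *m h = h *m rel_trace_mx r2 T R.
  rewrite /rel_trace_mx mulmx_sumr mulmx_suml.
  apply: eq_bigr => A0 /rcosetsP[y Ry ->]; rewrite homh //.
  have /rcosetP[t Tt ->] := mem_repr y (rcoset_refl T y).
  by rewrite groupM // (subsetP (proper_sub prT)).
by rewrite -mulmxA homTr mulmxA submxMr // intertwine_rfix // proper_sub.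
Qed.

End Intertwiner.

(** * The contribution of one double coset *)

Section OneDoubleCoset.

Variables (F : fieldType) (gT : finGroupType) (G K R : {group gT}) (n : nat).
Variables (sKG : K \subset G) (sRG : R \subset G).
Variables (V : mx_representation F K n) (x : gT).
Variables (Gx : x \in G) (sRKx : R \subset (K :^ x^-1)%G).

Local Notation M := (ind_repr G V).
Local Notation N := 'N_G(R)%G.
Local Notation Vx := (conj_repr V x).
Local Notation L := 'N_(K :^ x^-1)(R)%G.

Lemma norm_conj_sub : L \subset N.
Proof. by rewrite setSI // conj_subG ?groupV. Qed.

(** As (xkx^-1) x = x k, the block at x is a copy of ^xV. *)
Lemma ind_inj_conjJ g : g \in (K :^ x^-1)%G ->
  Vx g *m ind_inj G V x = ind_inj G V x *m M g.
Proof.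
move=> Kxg; have Kgx : (g ^ x)%g \in K by rewrite -mem_conjgV.
rewrite ind_injJ // conjgC ind_inj_mulr ?conjVg ?groupV //.
by rewrite invgK.
Qed.

Lemma ind_proj_conjJ g : g \in (K :^ x^-1)%G ->
  M g *m ind_proj G V x = ind_proj G V x *m Vx g.
Proof.
move=> Kxg; have Kgx : (g ^ x)%g \in K by rewrite -mem_conjgV.
have Gg : g \in G by apply: subsetP Kxg; rewrite conj_subG ?groupV.
by rewrite ind_projJ // conjgC ind_proj_mulr.
Qed.

Lemma norm_in g : g \in N -> g \in G.
Proof. by case/setIP. Qed.

(** The block at s x with s in N is the image of the block at x under the action
    of s, and both M^R and the space of traces are N-submodules.  So the next
    four lemmas reduce to s = 1, where the two coordinate maps commute with R. *)
Lemma ind_proj_rfix k (A : 'M_(k, _)) s : s \in N ->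
  (A <= rfix_mx M R)%MS -> (A *m ind_proj G V (s * x)%g <= rfix_mx Vx R)%MS.
Proof.
move=> Ns fixA; rewrite -ind_projJ ?(norm_in Ns) // mulmxA.
apply: (intertwine_rfix (R := R) (r1 := M)) => // [g Rg|].
  by rewrite ind_proj_conjJ // (subsetP sRKx).
apply: submx_trans (submxMr _ fixA) _.
exact: (mxmoduleP (fixed_module M sRG) s Ns).
Qed.

Lemma ind_inj_rfix k (A : 'M_(k, _)) s : s \in N ->
  (A <= rfix_mx Vx R)%MS -> (A *m ind_inj G V (s * x)%g <= rfix_mx M R)%MS.
Proof.
move=> Ns fixA.
have <- : ind_inj G V x *m M s^-1%g = ind_inj G V (s * x)%g.
  by rewrite ind_injJ // invgK.
rewrite mulmxA.
suff fixAx : (A *m ind_inj G V x <= rfix_mx M R)%MS.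
  apply: submx_trans (submxMr _ fixAx) _.
  by apply: (mxmoduleP (fixed_module M sRG)); rewrite groupV.
apply: (intertwine_rfix (R := R) (r1 := Vx)) => // g Rg.
by rewrite ind_inj_conjJ // (subsetP sRKx).
Qed.

Lemma ind_proj_trace k (A : 'M_(k, _)) s : s \in N ->
  (A <= trace_space M R)%MS ->
  (A *m ind_proj G V (s * x)%g <= trace_space Vx R)%MS.
Proof.
move=> Ns trA; rewrite -ind_projJ ?(norm_in Ns) // mulmxA.
apply: (intertwine_trace (r1 := M)) => [g Rg|].
  by rewrite ind_proj_conjJ // (subsetP sRKx).
apply: submx_trans (submxMr _ trA) _.
exact: (mxmoduleP (trace_module M sRG) s Ns).
Qed.

Lemma ind_inj_trace k (A : 'M_(k, _)) s : s \in N ->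
  (A <= trace_space Vx R)%MS ->
  (A *m ind_inj G V (s * x)%g <= trace_space M R)%MS.
Proof.
move=> Ns trA.
have <- : ind_inj G V x *m M s^-1%g = ind_inj G V (s * x)%g.
  by rewrite ind_injJ // invgK.
rewrite mulmxA.
suff trAx : (A *m ind_inj G V x <= trace_space M R)%MS.
  apply: submx_trans (submxMr _ trAx) _.
  by apply: (mxmoduleP (trace_module M sRG)); rewrite groupV.
apply: (intertwine_trace (r1 := Vx)) => // g Rg.
by rewrite ind_inj_conjJ // (subsetP sRKx).
Qed.

Variables (m : nat) (Bx : mx_representation F L m) (q : 'M[F]_(n, m)).
Hypothesis quotBx :
  quotient_map (norm_repr Vx R) (trace_space Vx R) (rfix_mx Vx R) Bx q.

(** The block at s x, s in N, is reduced modulo traces by q and becomes the block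
    at s of the module induced to N.  The representatives of the cosets sL enter
    only through this formula: [mackey_map_proj] gives the coordinate at every
    s. *)
Definition mackey_map :=
  \sum_(C in lcosets L N)
     ind_proj G V (repr C * x)%g *m q *m ind_inj N Bx (repr C).

(** Replacing s by s l with l in L multiplies both sides by the action of l; on
    the right this uses the equivariance of q, which holds on fixed vectors. *)
Lemma mackey_map_proj k (A : 'M_(k, _)) s : s \in N ->
  (A <= rfix_mx M R)%MS ->
  A *m mackey_map *m ind_proj N Bx s = A *m ind_proj G V (s * x)%g *m q.
Proof.
move=> Ns fixA; have sLN := norm_conj_sub.
have SC : (s *: L)%g \in lcosets L N by apply/lcosetsP; exists s.
rewrite /mackey_map -mulmxA mulmx_suml (bigD1 (s *: L)%g) //=.
rewrite [X in _ *m (_ + X)]big1 ?addr0.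
  have /lcosetP[l Ll ->] := mem_repr s (lcoset_refl L s).
  have Nsl : (s * l)%g \in N by rewrite groupM // (subsetP sLN).
  rewrite -(mulmxA _ _ (ind_proj _ _ _)) ind_injK // /zero_ext invMg mulgKV groupV Ll.
  have [_ _ equi] := quotBx.
  rewrite !mulmxA -equi ?groupV //; last exact: ind_proj_rfix.
  have Kl : (l ^ x)%g \in K by case/setIP: Ll => Kl _; rewrite -mem_conjgV.
  rewrite /= -(mulmxA A) -ind_proj_mulr; last by rewrite conjVg groupV.
  by rewrite -mulgA -conjgC !mulgA mulgK.
move=> _ /andP[/lcosetsP[t Nt ->] ne].
have /lcosetP[l Ll ->] := mem_repr t (lcoset_refl L t).
have Ntl : (t * l)%g \in N by rewrite groupM // (subsetP sLN).
rewrite -mulmxA ind_injK // /zero_ext invMg -(mulgA l^-1%g) groupMl ?groupV //.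
case: ifP => Lts; last by rewrite !mulmx0.
by case/eqP: ne; apply/lcoset_eqP; rewrite mem_lcoset -groupV invMg invgK.
Qed.

Lemma mackey_mapJ k (A : 'M_(k, _)) g : g \in N -> (A <= rfix_mx M R)%MS ->
  A *m M g *m mackey_map = A *m mackey_map *m ind_repr N Bx g.
Proof.
move=> Ng fixA; have sLN := norm_conj_sub.
apply: (ind_proj_inj sLN (rV := Bx)) => s Ns.
have fixAg : (A *m M g <= rfix_mx M R)%MS.
  apply: submx_trans (submxMr _ fixA) _.
  exact: (mxmoduleP (fixed_module M sRG) g Ng).
rewrite mackey_map_proj // -[RHS]mulmxA (ind_projJ sLN) //.
rewrite mackey_map_proj ?groupM // -(mulmxA A) ind_projJ ?(norm_in Ng) //.
by rewrite mulgA.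
Qed.

Lemma mackey_map_eq0 k (A : 'M_(k, _)) : (A <= rfix_mx M R)%MS ->
  A *m mackey_map = 0 <->
  (forall s, s \in N -> (A *m ind_proj G V (s * x)%g <= trace_space Vx R)%MS).
Proof.
move=> fixA; have [_ kerq _] := quotBx; split=> [A0 s Ns|trA].
  by rewrite -kerq ?ind_proj_rfix // -mackey_map_proj // A0 mul0mx.
apply: (ind_proj_inj norm_conj_sub (rV := Bx)) => s Ns.
rewrite mackey_map_proj // mul0mx; apply/eqP.
by rewrite kerq ?ind_proj_rfix // trA.
Qed.

Lemma ind_inj_mackey_map k (B : 'M_(k, n)) s : s \in N ->
  (B <= rfix_mx Vx R)%MS ->
  B *m ind_inj G V (s * x)%g *m mackey_map = B *m q *m ind_inj N Bx s.
Proof.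
move=> Ns fixB; have [_ _ equi] := quotBx; have sLN := norm_conj_sub.
apply: (ind_proj_inj sLN (rV := Bx)) => s' Ns'.
rewrite mackey_map_proj ?ind_inj_rfix // -(mulmxA B).
rewrite -[RHS]mulmxA (ind_injK Bx) // (ind_injK V) ?groupM ?(norm_in Ns) //.
have -> : ((s * x)^-1 * (s' * x) = (s^-1 * s') ^ x)%g.
  by rewrite invMg conjgE !mulgA.
have Nss' : (s^-1 * s')%g \in N by rewrite groupM ?groupV.
have KL : ((s^-1 * s') ^ x \in K)%g = (s^-1 * s' \in L)%g.
  rewrite -mem_conjgV in_setI andb_idr // => _.
  by case/setIP: Nss'.
rewrite /zero_ext KL; case: ifP => Lss'; last by rewrite !mulmx0 mul0mx.
by rewrite -equi.
Qed.

(** The witness is the sum of the copies of (^xV)^R in the blocks s x (x) V, s in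
    N: their images are the blocks of the induced module.  The witness has no coordinate in any other double coset N y K,
    since a coordinate at s y of a vector at s' x is nonzero only if
    x^-1 s'^-1 s y lies in K. *)
Lemma mackey_section : exists A : 'M_(\sum_(i < #|lcosets K G|) n),
  [/\ (A <= rfix_mx M R)%MS, row_full (A *m mackey_map)
    & forall y, (forall s, s \in N -> (x^-1 * s * y)%g \notin K) ->
      forall s, s \in N -> A *m ind_proj G V (s * y)%g = 0].
Proof.
have [fullq _ _] := quotBx; have sLN := norm_conj_sub.
have repN C : C \in lcosets L N -> repr C \in N by apply: repr_lcosets_mem.
pose W C := rfix_mx Vx R *m ind_inj G V (repr C * x)%g.
exists (\sum_(C in lcosets L N) <<W C>>)%MS; split=> [||y ny s Ns].
- by apply/sumsmx_subP => C SC; rewrite genmxE ind_inj_rfix ?repN.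
- rewrite -sub1mx -(sum_coset_proj sLN Bx); apply: summx_sub => C SC.
  rewrite /coset_proj mulmx_sub //.
  apply: (submx_trans (B := W C *m mackey_map)); last first.
    by rewrite submxMr // (sumsmx_sup C) // genmxE.
  rewrite ind_inj_mackey_map ?repN //.
  have /submxP[D eD] : (1%:M <= rfix_mx Vx R *m q)%MS by rewrite submx_full.
  by apply/submxP; exists D; rewrite mulmxA -eD mul1mx.
apply/sub_kermxP/sumsmx_subP => C SC; rewrite genmxE; apply/sub_kermxP.
rewrite -mulmxA ind_injK ?groupM ?(norm_in (repN C SC)) // /zero_ext ifN ?mulmx0 //.
rewrite invMg -!mulgA (mulgA _ s) (mulgA x^-1%g).
by apply: ny; rewrite groupM ?groupV ?repN.
Qed.

End OneDoubleCoset.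

(** * Cosets that R does not fix contribute only traces *)

Section NonFixedCosets.

Variables (F : fieldType) (gT : finGroupType) (G K R : {group gT}) (n : nat).
Variables (sKG : K \subset G) (sRG : R \subset G).
Variable V : mx_representation F K n.

Local Notation M := (ind_repr G V).

Lemma coset_projJ t g : t \in G -> g \in G ->
  coset_proj G V (t *: K)%g *m M g = M g *m coset_proj G V (g^-1 * t *: K)%g.
Proof.
move=> Gt Gg; rewrite !coset_projE -mulmxA ind_injJ // mulmxA ind_projJ //.
by rewrite mulKVg.
Qed.

Lemma rfix_coset_projJ k (A : 'M_(k, _)) t g : t \in G -> g \in R ->
  (A <= rfix_mx M R)%MS ->
  A *m coset_proj G V (t *: K)%g *m M g = A *m coset_proj G V (g^-1 * t *: K)%g.
Proof.
move=> Gt Rg /rfix_mxP fixA.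
by rewrite -mulmxA (coset_projJ Gt (subsetP sRG g Rg)) mulmxA fixA.
Qed.

(** Orbit-stabiliser for R acting on the cosets of K: the orbit of tK consists of
    the cosets contained in R t K, and the stabiliser is R :&: tKt^-1.  The
    representatives are inverted because the matrices act from the right. *)
Lemma orbit_lcosets t : t \in G ->
  [set C in lcosets K G | (R * C == R * (t *: K))%g]
  = [set ((repr A)^-1 * t *: K)%g | A in rcosets (R :&: K :^ t^-1) R].
Proof.
move=> Gt; have rep A : A \in rcosets (R :&: K :^ t^-1) R -> repr A \in R.
  exact: (repr_rcosets_mem (subsetIl _ _)).
apply/setP => C; apply/setIdP/imsetP => [[/lcosetsP[c Gc ->] /eqP eR]|[A SA ->]].
  have : c \in (R * (t *: K))%g.
    by rewrite -eR (subsetP (mulG_subr R _)) ?lcoset_refl.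
  case/mulsgP => r _ Rr /lcosetP[k Kk ->] ->.
  exists ((R :&: K :^ t^-1) :* r^-1)%g.
    by apply/rcosetsP; exists r^-1%g; rewrite ?groupV.
  have /rcosetP[z /setIP[_ Kz] ->] :=
    mem_repr r^-1%g (rcoset_refl (R :&: K :^ t^-1)%G r^-1%g).
  apply/lcoset_eqP; rewrite mem_lcoset !invMg !invgK !mulgA.
  rewrite mulgKV groupMr // -mulgA -conjgE.
  by rewrite -mem_conjgV.
have RA := rep A SA; split; last by rewrite lcosetM mulgA rcoset_id // groupV.
apply/lcosetsP; exists ((repr A)^-1 * t)%g => //.
by rewrite groupM // groupV (subsetP sRG).
Qed.

(** With w the component of A in the block tK and S the stabiliser of that block,
    the sum of the components of A over the orbit is Tr_S^R(w).  S is proper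
    exactly because R does not fix tK. *)
Lemma orbit_sum_trace k (A : 'M_(k, _)) t : t \in G ->
    ~~ (R \subset K :^ t^-1)%g -> (A <= rfix_mx M R)%MS ->
  ((\sum_(C in lcosets K G | (R * C == R * (t *: K))%g) A *m coset_proj G V C)%R
     <= trace_space M R)%MS.
Proof.
move=> Gt nRK fixA; pose S := (R :&: K :^ t^-1)%G.
have prS : S \proper R by rewrite properE subsetIl subsetI subxx.
have rep B : B \in rcosets S R -> repr B \in R.
  exact: (repr_rcosets_mem (subsetIl _ _)).
rewrite (eq_bigl (mem [set C in lcosets K G | (R * C == R * (t *: K))%g]));
  last first.
  by move=> C; rewrite !inE.
rewrite orbit_lcosets // big_imset /=; last first.
  move=> B C SB SC /lcoset_eqP; rewrite mem_lcoset invMg invgK.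
  have [RB RC] := (rep B SB, rep C SC).
  case/rcosetsP: SB RB => b Rb ->; case/rcosetsP: SC RC => c Rc ->.
  have /rcosetP[z Sz ->] := mem_repr b (rcoset_refl S b).
  have /rcosetP[z' Sz' ->] := mem_repr c (rcoset_refl S c).
  move=> Rzb Rzc Kbc; apply/rcoset_eqP; rewrite mem_rcoset.
  (* The representatives of S b and S c are z b and z' c. *)
  suff: (z' * c * (z * b)^-1)%g \in S.
    by rewrite invMg !mulgA groupMr ?groupV // -mulgA groupMl // -groupV invMg invgK.
  rewrite inE groupM ?groupV //= mem_conjgV conjgE; move: Kbc.
  by rewrite !mulgA.
pose w := A *m coset_proj G V (t *: K)%g.
rewrite (eq_bigr (fun B => w *m M (repr B))) => [|B SB]; last first.
  by rewrite /w rfix_coset_projJ // rep.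
rewrite -mulmx_sumr -/(rel_trace_mx M S R).
apply: (sumsmx_sup S) => //; apply: submxMr; apply/rfix_mxP => z /setIP[Rz Kz].
rewrite rfix_coset_projJ //; congr (_ *m coset_proj _ _ _).
apply/lcoset_eqP; rewrite mem_lcoset -conjgE conjVg.
by rewrite groupV -mem_conjgV.
Qed.

(** The cosets are grouped by the double coset R t K.  Inside a given R t K either
    none of the cosets is fixed by R, or all are, and then it is a single
    coset. *)
Lemma trace_space_fixed_cosets k (A : 'M_(k, _)) : (A <= rfix_mx M R)%MS ->
    (forall t, t \in G -> (R \subset K :^ t^-1)%g ->
       (A *m coset_proj G V (t *: K)%g <= trace_space M R)%MS) ->
  (A <= trace_space M R)%MS.
Proof.
move=> fixA trA; rewrite -[A]mulmx1 -(sum_coset_proj sKG V) mulmx_sumr.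
rewrite (partition_big (fun C => R * C)%g
           (mem [set R * C | C in lcosets K G]%g)) /=; last first.
  by move=> C SC; apply: imset_f.
apply: summx_sub => _ /imsetP[_ /lcosetsP[t Gt ->] ->].
have [sRK|nRK] := boolP (R \subset K :^ t^-1)%g; last exact: orbit_sum_trace.
apply: summx_sub => _ /andP[/lcosetsP[c Gc ->] /eqP eR]; apply: trA => //.
have : c \in (R * (t *: K))%g by rewrite -eR (subsetP (mulG_subr R _)) ?lcoset_refl.
case/mulsgP => r _ Rr /lcosetP[z Kz ->] ->.
rewrite !invMg !conjsgM (conjGid (groupVr Kz)) -{1}(conjGid (groupVr Rr)).
by rewrite conjSg.
Qed.

End NonFixedCosets.

(** * Double coset representatives and the decomposition *)

Section DoubleCosets.

Variables (gT : finGroupType) (G N K : {group gT}) (X : {set gT}).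
Hypothesis repsX : double_coset_reps G N K X.

Lemma double_coset_reps_sub : X \subset G.
Proof. by case/and3P: repsX. Qed.

Lemma double_coset_reps_cover t : t \in G ->
  exists x s k, [/\ x \in X, s \in N, k \in K & t = (s * x * k)%g].
Proof.
move=> Gt; case/and3P: repsX => _ _ /forall_inP/(_ _ (imset_f _ Gt))/cards1P[x eX].
have /setIP[Xx] : x \in X :&: (N :* t * K)%g by rewrite eX set11.
case/mulsgP => _ k /rcosetP[s Ns ->] Kk ex.
exists x, s^-1%g, k^-1%g; split; rewrite ?groupV //.
by rewrite ex !mulgA mulVg mul1g mulgK.
Qed.

Lemma double_coset_reps_uniq x y s : x \in X -> y \in X -> s \in N ->
  (x^-1 * s * y)%g \in K -> x = y.
Proof.
move=> Xx Xy Ns Kxy; have Gx := subsetP double_coset_reps_sub x Xx.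
case/and3P: repsX => _ _ /forall_inP/(_ _ (imset_f _ Gx))/cards1P[z eX].
have /set1P-> : x \in [set z].
  by rewrite -eX inE Xx -[x in x \in _]mulg1 mem_mulg ?rcoset_refl.
have /set1P-> // : y \in [set z].
rewrite -eX inE Xy; apply/mulsgP; exists (s^-1 * x)%g (x^-1 * s * y)%g => //.
  by rewrite mem_rcoset mulgK groupV.
by rewrite !mulgA mulgK mulVg mul1g.
Qed.

End DoubleCosets.

Theorem proposition1p7 (F : fieldType) (p : nat) (charF : p \in [pchar F])
    (gT : finGroupType) (G K R : {group gT})
    (sKG : K \subset G) (sRG : R \subset G) (pR : p.-group R)
    (n : nat) (V : mx_representation F K n) (permV : p_permutation p V)
    (X : {set gT}) (repsX : double_coset_reps G 'N_G(R) K X) :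
  mx_rsim
    (brauer_repr (ind_repr G V) sRG)
    (\big[dadd_grepr/grepr0]_(x : {x : gT | (x \in X) && (R \subset K :^ x^-1)})
       Representation
         (ind_repr 'N_G(R)%G
            (brauer_repr (conj_repr V (val x)) (proj2 (andP (valP x)))))).
Proof.
have sXG := double_coset_reps_sub repsX.
pose I := {x : gT | (x \in X) && (R \subset K :^ x^-1)}.
pose sRKx (i : I) : R \subset (K :^ (val i)^-1)%G := proj2 (andP (valP i)).
have Xi (i : I) : val i \in X by case/andP: (valP i).
have Gi (i : I) : val i \in G by apply: subsetP (Xi i).
pose B (i : I) := brauer_repr (conj_repr V (val i)) (sRKx i).
pose q (i : I) := brauer_proj R (conj_repr V (val i)).
have quotB (i : I) := brauer_projP (conj_repr V (val i)) (sRKx i).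
pose r (i : I) := Representation (ind_repr 'N_G(R)%G (B i)).
pose f (i : I) : 'M[F]_(_, rdegree (r i)) := mackey_map G V (B i) (q i).
have [h [kerh equih fullh]] :=
  dsum_joint_map (norm_repr (ind_repr G V) R) f (index_enum_uniq I).
apply: (quotient_map_rsim (fixed_module _ sRG) (brauer_projP _ sRG) (f2 := h)).
split=> [|k A fixA|k A g Ng fixA].
- apply: fullh => i _.
  have [A [fixA fullA A0]] := mackey_section sKG sRG (Gi i) (sRKx i) (quotB i).
  exists A; split=> // j _ nji.
  apply/(mackey_map_eq0 sKG sRG (Gi j) (sRKx j) (quotB j) fixA) => s Ns.
  rewrite A0 ?sub0mx // => s' Ns'; apply: contra nji => Kij; apply/eqP/val_inj.
  exact/esym/(double_coset_reps_uniq repsX (Xi i) (Xi j) Ns' Kij).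
- apply/eqP/idP => [/kerh A0|trA]; last first.
    apply/kerh => i _.
    apply/(mackey_map_eq0 sKG sRG (Gi i) (sRKx i) (quotB i) fixA) => s Ns.
    exact: ind_proj_trace.
  apply: trace_space_fixed_cosets => // t Gt sRKt.
  have [x [s [z [Xx Ns Kz et]]]] := double_coset_reps_cover repsX Gt.
  (* With t = s x z, the condition on t is conjugate by s to that on x, and s
     normalises R. *)
  have sRKx0 : R \subset K :^ x^-1.
    case/setIP: (Ns) => _ /normP nRs; rewrite -nRs -(conjSg _ _ s^-1%g).
    by move: sRKt; rewrite et !invMg !conjsgM (conjGid (groupVr Kz)) conjsgK.
  have Px : (x \in X) && (R \subset K :^ x^-1) by rewrite Xx.
  pose i : I := Sub x Px.
  rewrite et; have -> : (s * x * z *: K = s * x *: K)%g.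
    by apply/lcoset_eqP; rewrite mem_lcoset mulKg.
  rewrite coset_projE mulmxA -[x]/(val i).
  apply: (ind_inj_trace sRG (Gi i) (sRKx i)) => //.
  have eq0 := mackey_map_eq0 sKG sRG (Gi i) (sRKx i) (quotB i) fixA.
  exact: (eq0.1 (A0 i (mem_index_enum i)) s Ns).
- by apply: equih => i _; apply: (mackey_mapJ sKG sRG (Gi i) (sRKx i) (quotB i)).
Qed.
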